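(* Let $\mathbf{k}\ge 2$ and $\varphi\ge 2$ be integers such that $\mathbf{Bl}(\mathbf{k},\varphi)$ is nonempty. A block graph $G\in\mathbf{Bl}(\mathbf{k},\varphi)$ is a graph with maximal spectral radius in $\mathbf{Bl}(\mathbf{k},\varphi)$ if and only if $G\cong\mathbb{B}_{\mathbf{k},\varphi}$, where $\mathbb{B}_{\mathbf{k},\varphi}$ is the block graph with a single central cut vertex $c$ whose blocks (all containing $c$) are: if $\varphi$ is odd, one $K_2$, $\frac{\varphi-3}{2}$ copies of $K_3$ and one $K_{\mathbf{k}-\varphi+2}$; if $\varphi$ is even, $\frac{\varphi-2}{2}$ copies of $K_3$ and one $K_{\mathbf{k}-\varphi+2}$. In particular, the maximum of $\rho(G)$ over $G\in\mathbf{Bl}(\mathbf{k},\varphi)$ is attained uniquely (up to isomorphism) by $\mathbb{B}_{\mathbf{k},\varphi}$.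
   Context: All graphs are finite, simple and connected. A block of $G$ is a maximal connected subgraph without a cut vertex. A block graph is a connected graph each of whose blocks is a complete graph. A dissociation set is a vertex set inducing a subgraph of maximum degree at most $1$; the dissociation number $\varphi(G)$ is the maximum size of one. $\mathbf{Bl}(\mathbf{k},\varphi)$ is the class of block graphs on $\mathbf{k}$ vertices with dissociation number $\varphi$. $\rho(G)$ is the spectral radius of the adjacency matrix of $G$. $\widehat G\in\mathbf{Bl}(\mathbf{k},\varphi)$ is a graph with maximal spectral radius in $\mathbf{Bl}(\mathbf{k},\varphi)$ if $\rho(G)\le\rho(\widehat G)$ for all $G\in\mathbf{Bl}(\mathbf{k},\varphi)$. *)

(* Defs.v *)
From mathcomp Require Import all_boot all_order all_algebra all_fingroup all_field.
Set Implicit Arguments. Unset Strict Implicit. Unset Printing Implicit Defensive.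
Import Order.TTheory GRing.Theory Num.Theory.

Definition simple_graph (k : nat) (g : rel 'I_k) : Prop :=
  irreflexive g /\ symmetric g.

Definition connected_in (k : nat) (g : rel 'I_k) (S : {set 'I_k}) (x y : 'I_k) : bool :=
  connect [rel u v | [&& u \in S, v \in S & g u v]] x y.

Definition connected_set (k : nat) (g : rel 'I_k) (S : {set 'I_k}) : Prop :=
  S != set0 /\ forall x y, x \in S -> y \in S -> connected_in g S x y.

Definition connected_graph (k : nat) (g : rel 'I_k) : Prop :=
  connected_set g [set: 'I_k].

Definition cut_vertex_of (k : nat) (g : rel 'I_k) (S : {set 'I_k}) (v : 'I_k) : Prop :=
  v \in S /\ exists x y, [/\ x \in S :\ v, y \in S :\ v & ~~ connected_in g (S :\ v) x y].

Definition nonseparable_set (k : nat) (g : rel 'I_k) (S : {set 'I_k}) : Prop :=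
  connected_set g S /\ forall v, ~ cut_vertex_of g S v.

(* A block: a maximal connected subgraph without cut vertex.  Such a maximal
   subgraph is always the induced subgraph on its vertex set, so blocks are
   identified with the inclusion-maximal vertex sets S with G[S] nonseparable. *)
Definition block (k : nat) (g : rel 'I_k) (S : {set 'I_k}) : Prop :=
  nonseparable_set g S /\
  forall T : {set 'I_k}, S \subset T -> nonseparable_set g T -> T = S.

Definition clique (k : nat) (g : rel 'I_k) (S : {set 'I_k}) : Prop :=
  forall x y, x \in S -> y \in S -> x != y -> g x y.

Definition block_graph (k : nat) (g : rel 'I_k) : Prop :=
  simple_graph g /\ connected_graph g /\ forall S, block g S -> clique g S.

Definition dissociation_set (k : nat) (g : rel 'I_k) (D : {set 'I_k}) : bool :=
  [forall x in D, #|[set y in D | g x y]| <= 1].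

Definition dissociation_number (k : nat) (g : rel 'I_k) : nat :=
  \max_(D : {set 'I_k} | dissociation_set g D) #|D|.

Definition in_Bl (k phi : nat) (g : rel 'I_k) : Prop :=
  block_graph g /\ dissociation_number g = phi.

Definition adj_mx (k : nat) (g : rel 'I_k) : 'M[algC]_k :=
  (\matrix_(i, j) (g i j)%:R)%R.

Definition eigenvalues (k : nat) (g : rel 'I_k) : seq algC :=
  sval (closed_field_poly_normal (char_poly (adj_mx g))).

Definition spectral_radius (k : nat) (g : rel 'I_k) : algC :=
  (\big[Num.max/0]_(z <- eigenvalues g) `|z|)%R.

Definition max_spectral_in_Bl (k phi : nat) (g : rel 'I_k) : Prop :=
  in_Bl phi g /\ forall h : rel 'I_k, in_Bl phi h -> (spectral_radius h <= spectral_radius g)%R.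

Definition isomorphic (k : nat) (g h : rel 'I_k) : Prop :=
  exists f : {perm 'I_k}, forall x y, h (f x) (f y) = g x y.

(* The graph B_{k,phi}.  Vertex 0 is the central cut vertex c.  Vertex v >= 1
   is put into the group (v-1 + phi %% 2)./2 if v-1 < phi-2, and into the group
   phi otherwise.  Blocks are {0} together with a group.
   - phi odd: vertex 1 alone (a K_2), vertices 2..phi-2 in (phi-3)/2 pairs
     (copies of K_3), vertices phi-1..k-1 (a K_{k-phi+2});
   - phi even: vertices 1..phi-2 in (phi-2)/2 pairs (copies of K_3),
     vertices phi-1..k-1 (a K_{k-phi+2}). *)
Definition B_group (phi v : nat) : nat :=
  if v.-1 < phi - 2 then (v.-1 + odd phi)./2 else phi.

Definition Bgraph (k phi : nat) : rel 'I_k :=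
  fun x y => (x != y) &&
    [|| (val x == 0) && (val y != 0),
        (val y == 0) && (val x != 0) |
        [&& val x != 0, val y != 0 & B_group phi x == B_group phi y]].
Arguments Bgraph : clear implicits.

(* Main.v *)
Require Import Defs.
From mathcomp Require Import all_boot all_order all_algebra all_fingroup all_field.
From mathcomp Require Import spectral sesquilinear ring zify.
Set Implicit Arguments. Unset Strict Implicit. Unset Printing Implicit Defensive.
Import Order.TTheory GRing.Theory Num.Theory.

(* Let [x > 0] be the Perron vector of a block graph [G], let [c] be a vertex
   where [x] is maximal, and split [G] into breadth-first levels from [c].  Every
   vertex other than [c] has one parent in the previous level, and adjacency
   inside a level is an equivalence relation whose classes are cliques.  Let [A]
   be the class of largest [x]-weight.  A maximum dissociation set yields a set
   [Q] of [phi - 2] vertices outside [c] and [A] in which every vertex has at most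
   one neighbour of its own level.  Put a copy [H] of B_(k,phi) on the vertices:
   centre [c], the pairs of adjacent vertices of [Q] inside its triangles, and
   the rest of the vertices, which includes [A], in the large clique.  Replacing
   the parent of each vertex by [c] does not decrease [x^T G x]; the edges lost
   between [Q] and the rest of a class are paid for by the new edges from that
   rest to [A].  Hence [rho G = x^T G x <= x^T H x <= rho H] for normalised [x].
   In case of equality [x] is also an eigenvector of [H], and comparing the rows
   of [c], of [A] and finally of every vertex in [G x = H x] forces [G = H]. *)

(** * Rayleigh quotients and the Perron vector *)

Section Rayleigh.
Local Open Scope ring_scope.
Local Open Scope sesquilinear_scope.

Variables (C : numClosedFieldType) (n : nat) (M : 'M[C]_n) (rho : C).
Hypothesis M_herm : M \is hermsymmx.
Hypothesis rho_ub : forall a, eigenvalue M a -> `|a| <= rho.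

Let P := spectralmx M.
Let d := spectral_diag M.

Lemma spectral_decomposition : M = P^t* *m diag_mx d *m P.
Proof.
rewrite -(invmx_unitary (spectral_unitarymx M)).
exact/orthomx_spectralP/hermitian_normalmx.
Qed.

(** Row [i] of [P] is an eigenvector for [d 0 i], so [rho] bounds this real number through its
    modulus. *)
Lemma spectral_diag_le i : d 0 i <= rho.
Proof.
have d_real : d 0 i \is Num.real.
  exact: (mxOverP (hermitian_spectral_diag_real M_herm)).
apply: le_trans (real_ler_norm d_real) _.
apply: rho_ub; apply/eigenvalueP; exists (row i P).
  rewrite -row_mul spectral_decomposition !mulmxA.
  rewrite (unitarymxP (spectral_unitarymx M)) mul1mx row_mul row_diag_mx.
  by rewrite -scalemxAl -rowE.
apply/eqP=> /(congr1 (mulmx^~ (P^t*))).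
rewrite mul0mx -row_mul (unitarymxP (spectral_unitarymx M)) => /rowP/(_ i).
by rewrite !mxE eqxx => /eqP; rewrite oner_eq0.
Qed.

(** In the orthonormal eigenbasis formed by the rows of [P] both forms are diagonal. The gap becomes
    a sum of nonnegative terms, which gives the Rayleigh bound and its equality case. *)
Lemma rayleigh_gap (z : 'rV[C]_n) (y := z *m P^t*) :
  rho * (z *m z^t*) 0 0 - (z *m M *m z^t*) 0 0
  = \sum_i (rho - d 0 i) * `|y 0 i| ^+ 2.
Proof.
have zE : z = y *m P by rewrite mulmxKtV ?spectral_unitarymx.
have ztE : z^t* = P^t* *m y^t* by rewrite zE trmx_mul map_mxM.
have PP : P *m P^t* = 1%:M by apply/unitarymxP/spectral_unitarymx.
have -> : z *m z^t* = y *m y^t*.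
  by rewrite ztE zE mulmxA -(mulmxA y) PP mulmx1.
have -> : z *m M *m z^t* = y *m diag_mx d *m y^t*.
  rewrite ztE spectral_decomposition !mulmxA -/y -(mulmxA _ P) PP mulmx1.
  by [].
rewrite !mxE mulr_sumr -sumrB; apply: eq_bigr => i _.
by rewrite mul_mx_diag normCK [y^t* i 0]mxE [y^T i 0]mxE [in LHS]mxE; ring.
Qed.

Lemma rayleigh_le (z : 'rV[C]_n) :
  (z *m M *m z^t*) 0 0 <= rho * (z *m z^t*) 0 0.
Proof.
rewrite -subr_ge0 rayleigh_gap sumr_ge0 // => i _.
by rewrite mulr_ge0 ?subr_ge0 ?spectral_diag_le // exprn_ge0.
Qed.

(** A vanishing gap kills every summand, so each coordinate of [z] in the eigenbasis is zero or
    belongs to the eigenvalue [rho]. *)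
Lemma rayleigh_eq (z : 'rV[C]_n) :
  (z *m M *m z^t*) 0 0 = rho * (z *m z^t*) 0 0 -> z *m M = rho *: z.
Proof.
move=> /esym/eqP; rewrite -subr_eq0 rayleigh_gap => sum0.
pose y := z *m P^t*.
have yd i : y 0 i * d 0 i = rho * y 0 i.
  have /eqP : (rho - d 0 i) * `|y 0 i| ^+ 2 = 0.
    have ge0 j : true -> 0 <= (rho - d 0 j) * `|y 0 j| ^+ 2.
      by move=> _; rewrite mulr_ge0 ?subr_ge0 ?spectral_diag_le // exprn_ge0.
    by apply: (psumr_eq0P ge0) => //; apply/eqP.
  rewrite mulf_eq0 expf_eq0 /= normr_eq0 subr_eq0 => /orP[/eqP->|/eqP->].
    exact: mulrC.
  by rewrite mul0r mulr0.
have zE : z = y *m P by rewrite mulmxKtV ?spectral_unitarymx.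
rewrite spectral_decomposition !mulmxA -/y zE scalemxAl; congr (_ *m _).
by apply/rowP=> i; rewrite mul_mx_diag mxE [RHS]mxE yd.
Qed.

End Rayleigh.

Section SpectralRadius.
Local Open Scope ring_scope.
Local Open Scope sesquilinear_scope.

Variables (k : nat).
Implicit Types (g h : rel 'I_k) (x : 'I_k -> algC).

Lemma eigenvaluesP g a : (a \in eigenvalues g) = eigenvalue (adj_mx g) a.
Proof.
rewrite eigenvalue_root_char /eigenvalues.
case: closed_field_poly_normal => r /= pE; rewrite [X in root X a]pE.
by rewrite (monicP (char_poly_monic _)) scale1r root_prod_XsubC.
Qed.

(** [algC] is only partially ordered; nonnegativity makes the running maximum real, hence comparable
    with the next modulus. *)
Lemma bigmax_norm_ge0 (s : seq algC) : 0 <= \big[Num.max/0]_(z <- s) `|z|.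
Proof.
elim: s => [|z s IHs]; first by rewrite big_nil.
by rewrite big_cons; have [] := real_leP (normr_real z) (ger0_real IHs).
Qed.

Lemma bigmax_norm_ub (s : seq algC) a :
  a \in s -> `|a| <= \big[Num.max/0]_(z <- s) `|z|.
Proof.
elim: s => [//|z s IHs]; rewrite in_cons big_cons.
have [le_z|lt_z] := real_leP (normr_real z) (ger0_real (bigmax_norm_ge0 s)).
  by case/predU1P=> [->|/IHs].
by case/predU1P=> [->//|/IHs/le_trans-> //]; apply: ltW.
Qed.

Lemma bigmax_norm_attained (s : seq algC) : s != [::] ->
  exists2 a, a \in s & `|a| = \big[Num.max/0]_(z <- s) `|z|.
Proof.
elim: s => [//|z s IHs] _; rewrite big_cons.
have [le_z|_] := real_leP (normr_real z) (ger0_real (bigmax_norm_ge0 s)).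
  have [s0|s_n0] := eqVneq s [::].
    exists z; rewrite ?mem_head //; apply/eqP; rewrite eq_le le_z s0 big_nil.
    exact: normr_ge0.
  by have [a a_s aE] := IHs s_n0; exists a; rewrite // in_cons a_s orbT.
by exists z; rewrite ?mem_head.
Qed.

Lemma spectral_radius_ub g a : eigenvalue (adj_mx g) a -> `|a| <= spectral_radius g.
Proof. by rewrite -eigenvaluesP; apply: bigmax_norm_ub. Qed.

Lemma spectral_radius_attained g : (0 < k)%N ->
  exists2 a, eigenvalue (adj_mx g) a & `|a| = spectral_radius g.
Proof.
move=> k_gt0; have [a ev_a] := eigenvalue_closed (adj_mx g) k_gt0.
have /bigmax_norm_attained[b b_ev bE] : eigenvalues g != [::].
  by apply/eqP=> ev0; move: ev_a; rewrite -eigenvaluesP ev0.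
by exists b; rewrite // -eigenvaluesP.
Qed.

Lemma adj_mx_herm g : symmetric g -> adj_mx g \is hermsymmx.
Proof.
move=> g_sym; apply/is_hermitianmxP; rewrite expr0 scale1r.
by apply/matrixP=> i j; rewrite !mxE g_sym conjC_nat.
Qed.


Definition quad_form g x : algC := \sum_i \sum_j (g i j)%:R * (x i * x j).

Lemma quad_formE g x : (forall i, 0 <= x i) ->
  quad_form g x =
  ((\row_i x i) *m adj_mx g *m (\row_i x i)^t*) 0 0.
Proof.
move=> x_ge0; rewrite mxE /quad_form exchange_big /=; apply: eq_bigr => j _.
rewrite !mxE geC0_conj // mulr_suml; apply: eq_bigr => i _.
by rewrite !mxE mulrA (mulrC (x i)).
Qed.

Lemma norm2E x : (forall i, 0 <= x i) ->
  ((\row_i x i) *m (\row_i x i)^t*) 0 0 = \sum_i x i ^+ 2.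
Proof.
by move=> x_ge0; rewrite mxE; apply: eq_bigr => i _; rewrite !mxE geC0_conj.
Qed.

Lemma adj_eigen_eq g x rho : symmetric g ->
  (\row_i x i) *m adj_mx g = rho *: \row_i x i <->
  forall i, \sum_j (g i j)%:R * x j = rho * x i.
Proof.
move=> g_sym; split=> [/rowP E i|E]; last apply/rowP=> i; last rewrite !mxE -E.
  have := E i; rewrite !mxE => <-; apply: eq_bigr => j _.
  by rewrite !mxE g_sym mulrC.
by apply: eq_bigr => j _; rewrite !mxE g_sym mulrC.
Qed.

Lemma quad_form_le g x : symmetric g -> (forall i, 0 <= x i) ->
  quad_form g x <= spectral_radius g * \sum_i x i ^+ 2.
Proof.
move=> g_sym x_ge0; rewrite quad_formE // -norm2E //.
by apply: rayleigh_le; [apply: adj_mx_herm|apply: spectral_radius_ub].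
Qed.

Lemma quad_form_eq g x : symmetric g -> (forall i, 0 <= x i) ->
  quad_form g x = spectral_radius g * \sum_i x i ^+ 2 ->
  forall i, \sum_j (g i j)%:R * x j = spectral_radius g * x i.
Proof.
move=> g_sym x_ge0; rewrite quad_formE // -norm2E // => E.
apply/adj_eigen_eq => //.
by apply: rayleigh_eq E; [apply: adj_mx_herm|apply: spectral_radius_ub].
Qed.

Lemma eigen_quad_form g x rho :
  (forall i, \sum_j (g i j)%:R * x j = rho * x i) ->
  quad_form g x = rho * \sum_i x i ^+ 2.
Proof.
move=> E; rewrite mulr_sumr; apply: eq_bigr => i _.
rewrite expr2 mulrCA -E mulr_sumr; apply: eq_bigr => j _.
by rewrite mulrCA.
Qed.

(** Take the moduli of the entries of an eigenvector for an eigenvalue of largest modulus. By the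
    triangle inequality the result still reaches the Rayleigh bound, so it is an eigenvector for the
    spectral radius. *)
Lemma perron_nonneg g : symmetric g -> (0 < k)%N ->
  exists x, [/\ forall i, 0 <= x i, exists i, x i != 0 &
    forall i, \sum_j (g i j)%:R * x j = spectral_radius g * x i].
Proof.
move=> g_sym k_gt0; have [a ev_a aE] := spectral_radius_attained g k_gt0.
have [z zE z_n0] := eigenvalueP ev_a.
pose x i := `|z 0 i|; have x_ge0 i : 0 <= x i by apply: normr_ge0.
exists x; split=> //.
  have [i zi_n0] : exists i, z 0 i != 0.
    apply/existsP; apply: contraR z_n0; rewrite negb_exists => /forallP z0.
    by apply/eqP/rowP=> i; rewrite mxE; apply/eqP; rewrite -[_ == _]negbK z0.
  by exists i; rewrite normr_eq0.
apply: quad_form_eq => //; apply/eqP; rewrite eq_le quad_form_le //=.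
rewrite -aE mulr_sumr; apply: ler_sum => i _.
have : `|\sum_j z 0 j * (g j i)%:R| = `|a * z 0 i|.
  move/rowP/(_ i): zE; rewrite !mxE => <-; congr (`|_|).
  by apply: eq_bigr => j _; rewrite !mxE.
rewrite normrM => E; rewrite expr2 mulrA -E mulrC /x.
apply: le_trans (ler_wpM2l (normr_ge0 _) (ler_norm_sum _ _ _)) _.
rewrite mulr_sumr; apply: ler_sum => j _.
rewrite normrM normr_nat g_sym le_eqVlt; apply/predU1P; left.
by rewrite mulrA mulrC mulrCA.
Qed.

Lemma perron_vector g : symmetric g -> connected_graph g -> (0 < k)%N ->
  exists x, (forall i, 0 < x i) /\
    forall i, \sum_j (g i j)%:R * x j = spectral_radius g * x i.
Proof.
move=> g_sym [_ g_conn] k_gt0.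
have [x [x_ge0 [i0 xi0_n0] xE]] := perron_nonneg g_sym k_gt0.
exists x; split=> // i; rewrite lt0r x_ge0 andbT.
(* A zero entry spreads to all neighbours, since the row sum at [u] is then a vanishing sum of
   nonnegative terms; along a path it would reach [i0]. *)
have step u v : g u v -> x u = 0 -> x v = 0.
  move=> guv xu0; have := xE u; rewrite xu0 mulr0 => /psumr_eq0P.
  move/(_ _ v isT); rewrite guv mul1r; apply=> j _.
  by rewrite mulr_ge0.
have /connectP[p] := g_conn i i0 (in_setT _) (in_setT _).
elim: p i => [|v p IHp] u /=; first by move=> _ <-.
case/andP=> /and3P[_ _ guv] v_p i0E.
by apply: contraNneq (IHp v v_p i0E) => /(step _ _ guv) ->.
Qed.

(** Relabelling permutes the rows and columns of the characteristic matrix by the same permutation,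
    so the two signs of the determinant cancel. *)
Lemma spectral_radius_iso g h : isomorphic g h ->
  spectral_radius g = spectral_radius h.
Proof.
case=> f fE; rewrite /spectral_radius /eigenvalues; congr bigop.
suff -> : char_poly (adj_mx g) = char_poly (adj_mx h) by [].
have -> : char_poly (adj_mx g)
    = \det (row_perm f (col_perm f (char_poly_mx (adj_mx h)))).
  congr (\det _); apply/matrixP=> i j.
  by rewrite !mxE (inj_eq perm_inj) fE.
rewrite row_permE col_permE !det_mulmx !det_perm odd_permV.
by rewrite mulrCA -signr_addb addbb mulr1.
Qed.

End SpectralRadius.

(** * Levels of a block graph *)

Section Cycles.
Variables (k : nat) (g : rel 'I_k).

(** A boolean form of [nonseparable_set], so that [maxset_exists] can enlarge a set to a block. *)
Definition nonseparable (S : {set 'I_k}) : bool :=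
  [&& S != set0, [forall x in S, forall y in S, connected_in g S x y] &
      [forall v in S, forall x in S :\ v, forall y in S :\ v,
         connected_in g (S :\ v) x y]].

Lemma nonseparableP S : reflect (nonseparable_set g S) (nonseparable S).
Proof.
apply: (iffP and3P) => [[S_n0 S_conn S_cut]|[[S_n0 S_conn] S_cut]]; split => //.
- by split=> // x y xS; apply: (forall_inP (forall_inP S_conn _ xS)).
- move=> v [vS [x [y [xS yS /negP]]]]; apply.
  exact: (forall_inP (forall_inP (forall_inP S_cut _ vS) _ xS) _ yS).
- by do 2![apply/forall_inP=> ? ?]; apply: S_conn.
apply/forall_inP=> v vS; apply/forall_inP=> x xS; apply/forall_inP=> y yS.
by apply/negPn/negP=> ncon; apply: (S_cut v); split=> //; exists x, y.
Qed.

Hypotheses (g_sym : symmetric g) (g_blocks : forall S, block g S -> clique g S).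

Lemma nonseparable_clique S : nonseparable_set g S -> clique g S.
Proof.
move=> /nonseparableP S_ns; have [T /maxsetP[T_ns T_max] sST] := maxset_exists S_ns.
move=> x y xS yS; apply: (g_blocks (S := T)); try exact: (subsetP sST).
split=> [|U sTU U_ns]; first exact/nonseparableP.
by apply: T_max sTU; apply/nonseparableP.
Qed.

Lemma path_connected_in (S : {set 'I_k}) x p : path g x p -> {subset x :: p <= S} ->
  {in x :: p &, forall y z, connected_in g S y z}.
Proof.
move=> g_p sS.
have path_S : path [rel u v | [&& u \in S, v \in S & g u v]] x p.
  elim: p x g_p sS => //= y p IHp x /andP[gxy g_p] sS.
  rewrite !sS ?inE ?eqxx ?orbT // gxy IHp // => z z_p.
  by rewrite sS // in_cons z_p orbT.
have con_sym : connect_sym [rel u v | [&& u \in S, v \in S & g u v]].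
  by apply: sym_connect_sym => u v /=; rewrite g_sym andbCA.
move=> y z y_p z_p; apply: (@connect_trans _ _ x).
  by rewrite con_sym; apply: path_connect y_p.
exact: path_connect z_p.
Qed.

(** Deleting a vertex from a cycle leaves a path: rotate the cycle so that the deleted vertex comes
    first. *)
Lemma cycle_nonseparable x s :
  ucycle g (x :: s) -> nonseparable_set g [set y in x :: s].
Proof.
move=> uc_s; split.
  split; first by apply/set0Pn; exists x; rewrite !inE eqxx.
  case/andP: uc_s; rewrite /= rcons_path => /andP[g_s _] _ y z; rewrite !in_set.
  by apply: (path_connected_in g_s) => t; rewrite in_set.
move=> v [+ [y [z [yS zS /negP]]]]; rewrite in_set => v_s; apply.
have [i t rot_s] := rot_to v_s.
have {uc_s} : ucycle g (v :: t) by rewrite -rot_s /ucycle rot_cycle rot_uniq.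
have s_t : x :: s =i v :: t by move=> u; rewrite -rot_s mem_rot.
case/andP=> /= + /andP[v_t _]; rewrite rcons_path => /andP[g_t _].
have {}yS : y \in t by move: yS; rewrite in_setD1 in_set s_t in_cons; case: eqP.
have {}zS : z \in t by move: zS; rewrite in_setD1 in_set s_t in_cons; case: eqP.
case: t yS zS {rot_s} g_t v_t s_t => // w t yS zS /= /andP[_ g_t] v_t s_t.
apply: (path_connected_in g_t) => // u u_t.
rewrite in_setD1 in_set s_t in_cons u_t orbT andbT.
by apply: contraNneq v_t => <-.
Qed.

Lemma cycle_clique x s : ucycle g (x :: s) ->
  {in x :: s &, forall y z, y != z -> g y z}.
Proof.
move=> /cycle_nonseparable/nonseparable_clique cl y z y_s z_s.
by apply: cl; rewrite in_set.
Qed.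

End Cycles.

(** The level of a vertex is the least [n] for which the ball of radius [n] around [c] contains
    it. *)
Lemma bfs_levels (k : nat) (g : rel 'I_k) (c : 'I_k) : connected_graph g ->
  exists lvl : 'I_k -> nat,
   [/\ forall v, (lvl v == 0) = (v == c),
       forall u v, g u v -> lvl v <= (lvl u).+1 &
       forall v, 0 < lvl v -> exists2 u, g u v & lvl v = (lvl u).+1].
Proof.
case=> _ g_conn.
pose ball n := iter n (fun S => [set v | (v \in S) || [exists u in S, g u v]]) [set c].
have ballS n u v : u \in ball n -> g u v -> v \in ball n.+1.
  by move=> u_n guv; rewrite /= inE; apply/orP; right; apply/exists_inP; exists u.
have in_ball v : exists n, v \in ball n.
  have /connectP[p] := g_conn c v (in_setT _) (in_setT _).
  have: exists n, c \in ball n by exists 0; rewrite /= inE.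
  move: {1 2 3}c => u; elim: p u => [|w p IHp] u /=; first by move=> ? _ ->.
  move=> [n u_n] /andP[/and3P[_ _ guw] g_p]; apply: IHp => //.
  by exists n.+1; apply: ballS guw.
exists (fun v => ex_minn (in_ball v)); split=> [v|u v guv|v].
- case: ex_minnP => -[|n] v_n n_min; first by rewrite -in_set1.
  by apply/esym/negbTE; apply/eqP=> vc; have := n_min 0;
    rewrite vc /= inE eqxx => /(_ isT).
- case: ex_minnP => m v_m m_min; case: ex_minnP => n u_n n_min.
  by apply: m_min; apply: ballS guv.
case: ex_minnP => -[|n] v_n n_min //= _.
have v_Nn : v \notin ball n by apply/negP=> /n_min; rewrite ltnn.
move: (v_n); rewrite /= inE (negbTE v_Nn) /= => /exists_inP[u u_n guv].
exists u => //; congr _.+1; case: ex_minnP => m u_m m_min.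
apply/eqP; rewrite eqn_leq (m_min n u_n) andbT.
by rewrite -ltnS; apply: n_min; apply: ballS guv.
Qed.

Section Levels.
Variables (k : nat) (g : rel 'I_k) (c : 'I_k) (lvl : 'I_k -> nat).
Hypotheses (g_irr : irreflexive g) (g_sym : symmetric g).
Hypothesis (g_blocks : forall S, block g S -> clique g S).
Hypothesis lvl_eq0 : forall v, (lvl v == 0) = (v == c).
Hypothesis lvl_adj : forall u v, g u v -> lvl v <= (lvl u).+1.
Hypothesis lvl_parent :
  forall v, 0 < lvl v -> exists2 u, g u v & lvl v = (lvl u).+1.

Lemma edge_neq u v : g u v -> u != v.
Proof. by apply: contraTneq => ->; rewrite g_irr. Qed.

(* [u] and [u'] are joined by a path below level [d], apart from its ends; with
   [v] it forms a cycle, which lies in one block. *)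
Lemma level_fork d v u u' : 0 < d -> d <= lvl v -> lvl u = d -> lvl u' = d ->
  u != u' -> g v u -> g v u' -> g u u' /\ exists2 w, lvl w < d & g v w.
Proof.
move=> d_gt0 d_v u_d u'_d uu' gvu gvu'.
(* [T] holds the vertices allowed on the path. The relation [e] demands an end below level [d], so
   the path cannot be a single edge from [u] to [u']. *)
pose T a := [|| lvl a < d, a == u | a == u'].
pose e := [rel a b | [&& g a b, (lvl a < d) || (lvl b < d), T a & T b]].
have e_sym : symmetric e.
  by move=> a b; rewrite /= g_sym orbC; congr [&& _, _ & _]; apply: andbC.
have to_c a : T a -> connect e a c.
  have [n] := ubnP (lvl a); elim: n a => // n IHn a a_n Ta.
  have [a_gt0|] := ltnP 0 (lvl a); last first.
    by rewrite leqn0 lvl_eq0 => /eqP->; apply: connect0.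
  have [b gba bE] := lvl_parent a_gt0.
  have a_d : lvl a <= d by case/or3P: Ta => [/ltnW|/eqP->|/eqP->] //;
    rewrite ?u_d ?u'_d.
  have b_d : lvl b < d by rewrite bE in a_d.
  have Tb : T b by rewrite /T b_d.
  apply: connect_trans (IHn b _ Tb); last by rewrite bE in a_n.
  by apply: connect1; rewrite /= g_sym gba b_d orbT Ta Tb.
have Tu : T u by rewrite /T eqxx orbT.
have Tu' : T u' by rewrite /T eqxx !orbT.
have : connect e u u'.
  apply: connect_trans (to_c u Tu) _.
  by rewrite (sym_connect_sym e_sym); apply: to_c.
case/connectP=> p0 e_p0 u'E; case/shortenP: e_p0 u'E => -[|w p] e_p uniq_p _.
  by move/eqP; rewrite eq_sym (negbTE uu').
(* The first step of the path leaves level [d]; [w] becomes the lower neighbour of [v] once the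
   cycle is known to be a clique. *)
move=> u'E; have [guw w_d] : g u w /\ lvl w < d.
  by case/andP: e_p => /and4P[-> + _ _] _; rewrite u_d ltnn.
have T_p : all T (w :: p).
  have: path e u (w :: p) by [].
  by elim: (w :: p) (u) => //= a q IHq b /andP[/and4P[_ _ _ ->] /IHq].
have v_NT : ~~ T v.
  by rewrite /T ltnNge d_v /= negb_or !edge_neq.
have uc : ucycle g [:: v, u, w & p].
  rewrite /ucycle (cons_uniq v) uniq_p andbT; apply/andP; split.
    change (path g v (rcons [:: u, w & p] v)); rewrite rcons_path.
    change ((g v u && path g u (w :: p)) && g (last v [:: u, w & p]) v); rewrite gvu.
    have -> : last v [:: u, w & p] = u' by [].
    rewrite g_sym gvu' andbT; apply: sub_path e_p.
    by move=> a b /and4P[].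
  apply: contra v_NT; rewrite in_cons => /predU1P[->//|].
  exact: (allP T_p).
have := cycle_clique g_sym g_blocks uc; move=> cl; split; last exists w => //.
  apply: cl; rewrite // !inE ?eqxx ?orbT //.
  by have: u' \in w :: p; [rewrite u'E /= mem_last|rewrite inE => ->; rewrite !orbT].
apply: cl; rewrite ?inE ?eqxx ?orbT //.
by apply: contraTneq d_v => ->; rewrite -ltnNge.
Qed.

(** Two distinct parents would form a fork at [v], giving [v] a neighbour at least two levels
    lower. *)
Lemma parent_unique u u' v : g u v -> g u' v -> lvl v = (lvl u).+1 ->
  lvl v = (lvl u').+1 -> u = u'.
Proof.
move=> guv gu'v vE vE'; have [] := posnP (lvl u).
  move=> u0; have u'0 : lvl u' = 0 by move: vE'; rewrite vE u0 => -[].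
  by move/eqP: u0; move/eqP: u'0; rewrite !lvl_eq0 => /eqP-> /eqP->.
move=> u_gt0; apply/eqP/negPn/negP => uu'.
have u'u : lvl u' = lvl u by move: vE'; rewrite vE => -[].
have uv : lvl u <= lvl v by rewrite vE.
have [gvu gvu'] : g v u /\ g v u' by rewrite !(g_sym v).
have [_ [w w_u gvw]] := level_fork u_gt0 uv erefl u'u uu' gvu gvu'.
by rewrite g_sym in gvw; have := lvl_adj gvw; rewrite vE ltnS leqNgt w_u.
Qed.

Definition sib u v := g u v && (lvl u == lvl v).

Lemma sib_sym : symmetric sib.
Proof. by move=> u v; rewrite /sib g_sym eq_sym. Qed.

Lemma sib_neq u v : sib u v -> u != v.
Proof. by case/andP=> /edge_neq. Qed.

Lemma sib_lvl u v : sib u v -> lvl u = lvl v.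
Proof. by case/andP=> _ /eqP. Qed.

Lemma sib_root v : sib c v = false.
Proof.
apply/negP=> sib_cv; have := sib_lvl sib_cv; have := lvl_eq0 c.
rewrite eqxx => /eqP-> /esym/eqP; rewrite lvl_eq0 => /eqP vc.
by have := sib_neq sib_cv; rewrite vc eqxx.
Qed.

(** Two siblings of [v] form a fork at [v] within its own level, which lies above 0 because the root
    has no siblings. *)
Lemma sib_trans u v w : u != w -> sib u v -> sib v w -> sib u w.
Proof.
move=> uw sib_uv sib_vw.
have [uv vw] := (sib_lvl sib_uv, sib_lvl sib_vw).
case/andP: (sib_uv) (sib_vw) => guv _ /andP[gvw _].
have u_gt0 : 0 < lvl u.
  by rewrite lt0n lvl_eq0; apply: contraTneq sib_uv => ->; rewrite sib_root.
rewrite /sib uv vw eqxx andbT.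
have [u_v w_v gvu] : [/\ lvl v <= lvl v, lvl w = lvl v & g v u] by rewrite vw g_sym.
by rewrite uv in u_gt0; have [] := level_fork u_gt0 u_v uv w_v uw gvu gvw.
Qed.

(** The default [c] is reached only at the root; every other vertex has a parent. *)
Definition par v := odflt c [pick u | g u v && (lvl v == (lvl u).+1)].

Lemma par_unique u v : g u v -> lvl v = (lvl u).+1 -> u = par v.
Proof.
move=> guv vE; rewrite /par; case: pickP => [w /andP[gwv /eqP]|/(_ u)] /=.
  exact: parent_unique.
by rewrite guv vE eqxx.
Qed.

Lemma edge_cases u v : g u v ->
  [\/ sib u v, v != c /\ u = par v | u != c /\ v = par u].
Proof.
move=> guv; have guv' := guv; rewrite g_sym in guv'.
have [lt_uv|lt_vu|eq_uv] := ltngtP (lvl u) (lvl v); last by constructor 1;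
  rewrite /sib guv eq_uv eqxx.
  constructor 2; split; first by rewrite -lvl_eq0 -lt0n; apply: leq_trans lt_uv.
  by apply: par_unique => //; apply/eqP; rewrite eqn_leq lt_uv andbT lvl_adj.
constructor 3; split; first by rewrite -lvl_eq0 -lt0n; apply: leq_trans lt_vu.
by apply: par_unique => //; apply/eqP; rewrite eqn_leq lt_vu andbT lvl_adj.
Qed.

Lemma lvl1 y : (lvl y == 1) = g c y.
Proof.
have c0 : lvl c = 0 by apply/eqP; rewrite lvl_eq0.
apply/eqP/idP => [y1|gcy].
  have [|u guy] := @lvl_parent y; first by rewrite y1.
  by rewrite y1 => -[/esym/eqP]; rewrite lvl_eq0 => /eqP <-.
apply/eqP; rewrite eqn_leq lt0n lvl_eq0 eq_sym edge_neq // andbT.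
by have := lvl_adj gcy; rewrite c0.
Qed.

Lemma lvl_below v i : i <= lvl v -> exists u, lvl u = i.
Proof.
have [n] := ubnP (lvl v); elim: n v => // n IHn v v_n.
rewrite leq_eqVlt => /predU1P[->|i_v]; first by exists v.
have [u guv vE] := lvl_parent (leq_ltn_trans (leq0n i) i_v).
by apply: (IHn u); rewrite vE in v_n i_v.
Qed.

Lemma dissociation_inj D u v w : dissociation_set g D ->
  u \in D -> v \in D -> w \in D -> g u v -> g u w -> v = w.
Proof.
move=> /forall_inP D_dis uD vD wD guv guw.
by have /card_le1_eqP := D_dis u uD; apply; rewrite inE ?vD ?wD.
Qed.

Lemma dissociation_clique D A : dissociation_set g D -> clique g A ->
  #|D :&: A| <= 2.
Proof.
move=> D_dis A_cl; rewrite leqNgt; apply/negP=> /card_gt2P[x [y [z [[xDA yDA zDA]]]]].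
move: xDA yDA zDA; rewrite !inE => /andP[xD xA] /andP[yD yA] /andP[zD zA] [xy yz zx].
by move/eqP: yz; apply; apply: (dissociation_inj D_dis xD) => //;
  apply: A_cl => //; rewrite eq_sym.
Qed.

(** The sibling class of [a]; the vertex itself is added because [sib] is irreflexive. *)
Definition sibs a := [set v | (v == a) || sib a v].

Lemma sibs_sib a u v : u \in sibs a -> v \in sibs a -> u != v -> sib u v.
Proof.
rewrite !inE => /predU1P[->|au] /predU1P[->|av]; rewrite ?eqxx //.
  by rewrite sib_sym.
by move=> uv; apply: (@sib_trans _ a) => //; rewrite sib_sym.
Qed.

Lemma sibs_clique a : clique g (sibs a).
Proof. by move=> u v uA vA /(sibs_sib uA vA)/andP[]. Qed.

Lemma sibs_lvl a u : u \in sibs a -> lvl u = lvl a.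
Proof. by rewrite inE => /predU1P[->|/sib_lvl]. Qed.

(* If the root belongs to [D] and [D] has two vertices in the class of [a], one
   vertex of level 1 or 2 outside [D] compensates for the loss of the root. *)
Lemma spare_vertex a (D : {set 'I_k}) : a != c -> dissociation_set g D ->
  c \in D -> 1 < #|D :&: sibs a| ->
  exists z, [/\ z != c, z \notin D, z \notin sibs a &
    {in D &, forall u v, lvl u = lvl z -> lvl v = lvl z -> u = v}].
Proof.
move=> a_c D_dis cD /card_gt1P[b [b' []]].
rewrite !in_setI => /andP[bD bA] /andP[b'D b'A] bb'.
have D1 u v : u \in D -> v \in D -> lvl u = 1 -> lvl v = 1 -> u = v.
  by move=> uD vD /eqP + /eqP; rewrite !lvl1; apply: (dissociation_inj D_dis cD).
have a_ge2 : 1 < lvl a.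
  rewrite ltn_neqAle lt0n lvl_eq0 a_c andbT; apply: contraNneq bb' => a1.
  by apply/eqP/D1; rewrite ?(sibs_lvl bA) ?(sibs_lvl b'A).
(* A vertex of level 1 outside [D] serves: [a] has level at least 2, and [D] has at most one vertex
   of level 1. *)
case: (pickP [pred y | (lvl y == 1) && (y \notin D)]) => [y /andP[/eqP y1 yD]|D_L1].
  exists y; split=> //; first by rewrite -lvl_eq0 y1.
    by apply/negP=> /sibs_lvl; rewrite y1 => a1; rewrite -a1 in a_ge2.
  by move=> u v uD vD; rewrite y1; apply: D1.
(* Otherwise [D] contains all of level 1. A vertex of [D] at level 2 would give its parent a second
   neighbour in [D] besides [c], so level 2 misses [D] and any vertex there serves. *)
have L1_D y : lvl y = 1 -> y \in D.
  by move=> y1; have := D_L1 y; rewrite /= y1 eqxx => /negbFE.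
have L2_D u : lvl u = 2 -> u \notin D.
  move=> u2; apply/negP=> uD; have [|y gyu] := @lvl_parent u; first by rewrite u2.
  rewrite u2 => -[/esym y1]; have yD := L1_D y y1.
  have gcy : g c y by rewrite -lvl1 y1.
  suff cu : c = u by move: u2 => /eqP; rewrite -cu (eqP (_ : lvl c == 0)) ?lvl_eq0.
  by apply: (dissociation_inj D_dis yD) => //; rewrite g_sym.
have [z z2] := lvl_below a_ge2; exists z; split; rewrite ?L2_D //.
- by rewrite -lvl_eq0 z2.
- apply/negP=> /sibs_lvl; rewrite z2 -(sibs_lvl bA) => /esym/L2_D.
  by rewrite bD.
- by move=> u v uD _; rewrite z2 => /L2_D; rewrite uD.
Qed.

(** Removing the root costs [D] at most one vertex, and removing the clique [sibs a] at most two.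
    Only when all three are lost is a spare vertex added. *)
Lemma residual_set a (D : {set 'I_k}) : a != c -> dissociation_set g D ->
  exists Q : {set 'I_k}, [/\ Q \subset ~: (c |: sibs a), #|D| - 2 <= #|Q| &
    {in Q & &, forall u v w, sib u v -> sib u w -> v = w}].
Proof.
move=> a_c D_dis; pose E := D :\: (c |: sibs a).
have c_A : c \notin sibs a.
  by apply/negP=> /sibs_lvl /eqP;
    rewrite eq_sym (eqP (_ : lvl c == 0)) lvl_eq0 // (negbTE a_c).
have sE : E \subset ~: (c |: sibs a) by rewrite /E setDE subsetIr.
have sED u : u \in E -> u \in D by rewrite inE => /andP[].
have E_inj : {in E & &, forall u v w, sib u v -> sib u w -> v = w}.
  move=> u v w /sED uD /sED vD /sED wD /andP[guv _] /andP[guw _].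
  exact: (dissociation_inj D_dis uD).
have cardE : #|E| = #|D| - ((c \in D) + #|D :&: sibs a|).
  rewrite cardsD setIUr cardsU (_ : D :&: [set c] :&: (D :&: sibs a) = set0).
    rewrite cards0 subn0; congr (_ - (_ + _)); case: (boolP (c \in D)) => cD.
      by rewrite (setIidPr _) ?cards1 // sub1set.
    apply/eqP; rewrite cards_eq0 -subset0; apply/subsetP=> u.
    by rewrite !inE => /andP[uD /eqP uc]; rewrite -uc uD in cD.
  apply/setP=> u; rewrite !inE; case: (eqVneq u c) => [->|]; rewrite ?andbF //.
  by move: c_A; rewrite inE => /negbTE->; rewrite !andbF.
have DA_le2 := dissociation_clique D_dis (@sibs_clique a).
have [E_big|E_small] := leqP (#|D| - 2) #|E|; first by exists E.
have [cD DA_gt1] : c \in D /\ 1 < #|D :&: sibs a|.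
  move: E_small DA_le2; rewrite cardE; clear; case: (c \in D) => /=;
    move: #|D :&: sibs a| #|D| => m n; lia.
have [z [z_c zD zA z_lvl]] := spare_vertex a_c D_dis cD DA_gt1.
have zE : z \notin E by apply: contra zD => /sED.
exists (z |: E); split.
- by rewrite subUset sE andbT sub1set inE in_setU1 negb_or z_c.
- rewrite cardsU1 zE cardE cD; clear -DA_le2.
  by move: #|D :&: sibs a| #|D| DA_le2 => m n; lia.
(* At most one vertex of [D] has the level of [z], so the added vertex creates no second sibling. *)
move=> u v w; rewrite !in_setU1 => + + + uv uw.
have [uvl uwl] := (sib_lvl uv, sib_lvl uw).
case/predU1P=> [uz|uE] /predU1P[vz|vE] /predU1P[wz|wE]; subst=> //.
- by have := sib_neq uv; rewrite eqxx.
- by have := sib_neq uw; rewrite eqxx.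
- by apply: z_lvl; rewrite ?sED.
- by have /eqP[] := sib_neq uw; apply: z_lvl; rewrite ?sED // -uwl.
- by have /eqP[] := sib_neq uv; apply: z_lvl; rewrite ?sED // -uvl.
- exact: (E_inj u).
Qed.

End Levels.

(** * Placing B_(k,phi) on a vertex set *)

Lemma subset_of_card (T : finType) (Q : {set T}) n : n <= #|Q| ->
  exists2 Q' : {set T}, Q' \subset Q & #|Q'| = n.
Proof.
move=> n_Q; exists [set x in take n (enum Q)].
  by apply/subsetP=> x; rewrite inE => /mem_take; rewrite mem_enum.
rewrite cardsE (card_uniqP _) ?take_uniq ?enum_uniq //.
by rewrite size_takel // -cardE.
Qed.

(** [n + odd n] is even, so adding one does not change its half. *)
Lemma half_pair n : (n + odd n)./2 = (n.+1 + odd n)./2.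
Proof. by rewrite addSn -uphalfE uphalf_half oddD oddb addbb. Qed.

(** Related pairs are split off one at a time and put at the end of the list. Each fills two
    consecutive places, the first having the parity of [#|Q|]; after the shift by [odd #|Q|] both
    have the same half, as in [B_group]. *)
Lemma pair_enum (T : finType) (r : rel T) (Q : {set T}) : symmetric r ->
  {in Q & &, forall u v w, r u v -> r u w -> v = w} ->
  exists s, [/\ uniq s, s =i Q & {in Q &, forall u v, u != v -> r u v ->
    (index u s + odd #|Q|)./2 = (index v s + odd #|Q|)./2}].
Proof.
move=> r_sym; have [n] := ubnP #|Q|; elim: n Q => // n IHn Q Q_n r_inj.
case: (pickP [pred p : T * T | [&& p.1 \in Q, p.2 \in Q, p.1 != p.2 & r p.1 p.2]]).
  move=> [u v] /= /and4P[uQ vQ uv ruv]; pose Q' := Q :\ u :\ v.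
  have vQu : v \in Q :\ u by rewrite !inE eq_sym uv.
  have cardQ : #|Q| = #|Q'|.+2 by rewrite (cardsD1 u) uQ (cardsD1 v) vQu.
  have oddQ : odd #|Q| = odd #|Q'| by rewrite cardQ /= negbK.
  have sQ' x : x \in Q' -> x \in Q by rewrite !inE => /and3P[].
  have [||s [s_uniq sQ s_pair]] := IHn Q'; first by rewrite cardQ in Q_n;
    apply: leq_ltn_trans (leqnSn _) Q_n.
    by move=> x y z /sQ' xQ /sQ' yQ /sQ' zQ; apply: r_inj.
  have size_s : size s = #|Q'| by rewrite -(eq_card sQ); apply/esym/card_uniqP.
  have [u_s v_s] : u \notin s /\ v \notin s by rewrite !sQ !inE !eqxx ?andbF.
  have index_u : index u (s ++ [:: u; v]) = #|Q'|.
    by rewrite index_cat (negbTE u_s) /= eqxx addn0 size_s.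
  have index_v : index v (s ++ [:: u; v]) = #|Q'|.+1.
    by rewrite index_cat (negbTE v_s) /= (negbTE uv) eqxx size_s addn1.
  exists (s ++ [:: u; v]); split.
  - by rewrite cat_uniq s_uniq /= !negb_or u_s v_s uv.
  - move=> x; rewrite mem_cat sQ !inE.
    case: (eqVneq x v) => [->|_]; first by rewrite /= orbT vQ.
    by case: (eqVneq x u) => [->|_]; rewrite /= ?orbF ?uQ.
  move=> x y xQ yQ xy rxy; rewrite oddQ.
  have mem_Q' z : z \in Q -> z != u -> z != v -> z \in Q'.
    by move=> zQ zu zv; rewrite !inE zu zv.
  (* Partners are unique, so [u] and [v] are related only to each other and any other pair lies in
     [Q']. *)
  have [xu|xu] := eqVneq x u.
    have -> : y = v by apply: (r_inj x); rewrite // xu.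
    by rewrite xu index_u index_v half_pair.
  have [xv|xv] := eqVneq x v.
    have -> : y = u by apply: (r_inj x); rewrite // xv r_sym.
    by rewrite xv index_u index_v half_pair.
  have [yu|yu] := eqVneq y u.
    by case/eqP: xv; apply: (r_inj y); rewrite // ?yu // r_sym -yu.
  have [yv|yv] := eqVneq y v.
    by case/eqP: xu; apply: (r_inj y); rewrite // ?yv // r_sym // -yv.
  by rewrite !index_cat !sQ !mem_Q' //; apply: s_pair => //; apply: mem_Q'.
move=> no_pair; exists (enum Q); split=> [|x|u v uQ vQ uv ruv].
- exact: enum_uniq.
- by rewrite mem_enum.
by have := no_pair (u, v); rewrite /= uQ vQ uv ruv.
Qed.

Lemma Bgraph_sym k phi : symmetric (Bgraph k phi).
Proof.
move=> x y; rewrite /Bgraph eq_sym; congr (_ && _).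
by rewrite orbCA andbCA (eq_sym (B_group _ _)).
Qed.

(** List [c] first, then [Q] in paired order, then the other vertices, and send each vertex to its
    position. Thus [Q] occupies positions 1 to [phi - 2], and all later positions belong to the
    large clique. *)
Lemma Bgraph_placement k phi (r : rel 'I_k) (c : 'I_k) (Q : {set 'I_k}) :
  2 <= phi -> c \notin Q -> #|Q| = phi - 2 -> symmetric r -> irreflexive r ->
  {in Q & &, forall u v w, r u v -> r u w -> v = w} ->
  exists f : {perm 'I_k},
  [/\ forall v, v != c -> Bgraph k phi (f c) (f v),
      forall u v, u \notin c |: Q -> v \notin c |: Q -> u != v ->
        Bgraph k phi (f u) (f v) &
      {in Q &, forall u v, r u v -> Bgraph k phi (f u) (f v)}].
Proof.
move=> phi_ge2 cQ cardQ r_sym r_irr r_inj.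
have [s [s_uniq sQ s_pair]] := pair_enum r_sym r_inj.
have size_s : size s = phi - 2.
  by rewrite -cardQ -(eq_card sQ); apply/esym/card_uniqP.
pose L := c :: s ++ enum (~: (c |: Q)).
have mem_L v : v \in L.
  by rewrite in_cons mem_cat mem_enum sQ !inE; case: (v == c); case: (v \in Q).
have L_uniq : uniq L.
  rewrite /= mem_cat mem_enum sQ !inE eqxx /= orbF cQ cat_uniq s_uniq enum_uniq
    andbT /=.
  by apply/hasPn=> v; rewrite mem_enum sQ !inE negb_or => /andP[].
have size_L : size L = k.
  by rewrite -[RHS]card_ord -(card_uniqP L_uniq); apply: eq_card => v; rewrite mem_L.
have pos_lt v : index v L < k by rewrite -[X in _ < X]size_L index_mem.
have pos_inj : injective (fun v => Ordinal (pos_lt v)).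
  by move=> u v [] /(congr1 (nth c L)); rewrite !nth_index.
exists (perm pos_inj).
have pos_c : val (perm pos_inj c) = 0 by rewrite permE /= eqxx.
have pos_gt0 v : v != c -> val (perm pos_inj v) != 0.
  by rewrite permE /= eq_sym => /negbTE->.
have group_Q v : v \in Q ->
    v != c /\ B_group phi (perm pos_inj v) = (index v s + odd #|Q|)./2.
  move=> vQ; have vc : v != c by apply: contraNneq cQ => <-.
  split=> //; rewrite permE /B_group /= eq_sym (negbTE vc) index_cat sQ vQ /=.
  by rewrite -size_s index_mem sQ vQ cardQ oddB // addbF.
have group_A v : v \notin c |: Q -> v != c /\ B_group phi (perm pos_inj v) = phi.
  rewrite in_setU1 negb_or => /andP[vc vQ]; split=> //.
  rewrite permE /B_group /= eq_sym (negbTE vc) index_cat sQ (negbTE vQ) /=.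
  by rewrite size_s ltnNge leq_addr.
split=> [v vc|u v /group_A[uc uE] /group_A[vc vE] uv|u v uQ vQ ruv].
- by rewrite /Bgraph (inj_eq perm_inj) eq_sym vc pos_c pos_gt0.
- by rewrite /Bgraph (inj_eq perm_inj) uv uE vE eqxx !pos_gt0 ?orbT.
have uv : u != v by apply: contraTneq ruv => ->; rewrite r_irr.
have [[uc uE] [vc vE]] := (group_Q u uQ, group_Q v vQ).
by rewrite /Bgraph (inj_eq perm_inj) uv uE vE (s_pair u v) // eqxx !pos_gt0 ?orbT.
Qed.

(** * Membership of B_(k,phi) in its class *)

Lemma card_ord_range k (S : {set 'I_k}) m n :
  (forall v, v \in S -> m <= v < m + n) -> #|S| <= n.
Proof.
move=> S_mn; rewrite cardE -(size_map val) -[leqRHS](size_iota m).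
apply: uniq_leq_size; first by rewrite map_inj_uniq ?enum_uniq //; apply: val_inj.
by move=> i /mapP[v]; rewrite mem_enum mem_iota => /S_mn + ->.
Qed.

(** Walks avoiding the centre [z] stay in one group. As [z] is not a cut vertex of a block, a block
    meets at most one group apart from [z]. *)
Lemma Bgraph_block_graph k phi : 0 < k -> block_graph (Bgraph k phi).
Proof.
move=> k_gt0; pose z := Ordinal k_gt0.
have z0 v : (v == z) = (val v == 0) by rewrite -val_eqE.
have Bz v : v != z -> Bgraph k phi z v.
  by move=> vz; rewrite /Bgraph -!z0 [z == v]eq_sym vz eqxx.
have B_same (S : {set 'I_k}) x y : z \notin S -> x \in S ->
    connected_in (Bgraph k phi) S x y -> B_group phi x = B_group phi y.
  move=> zS xS /connectP[p]; elim: p x xS => [|w p IHp] x xS /=; first by move=> _ ->.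
  case/andP=> /and3P[_ wS] /andP[_] /orP + e_p yE.
  have [x0 w0] : val x != 0 /\ val w != 0.
    by rewrite -!z0; split; apply: contraNneq zS => <-.
  rewrite (negbTE x0) (negbTE w0) /= => -[|/eqP->] //.
  exact: IHp.
split; [split=> [x|]|split]; last first.
- move=> S [[[_ S_con] S_cut] _] x y xS yS xy.
  have [xz|xz] := eqVneq x z; first by rewrite xz Bz // eq_sym -xz.
  have [yz|yz] := eqVneq y z; first by rewrite yz Bgraph_sym Bz.
  suff BE : B_group phi x = B_group phi y.
    by rewrite /Bgraph xy -!z0 xz yz BE eqxx !orbT.
  have [zS|zS] := boolP (z \in S); last by apply: B_same (S_con x y xS yS).
  apply: (@B_same (S :\ z)); rewrite ?inE ?eqxx ?xz //.
  apply/negPn/negP=> ncon; apply: (S_cut z); split=> //.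
  by exists x, y; split; rewrite ?inE ?xz ?yz.
- split; first by apply/set0Pn; exists z.
  have B_sym := @Bgraph_sym k phi.
  have con_sym : connect_sym [rel u v | [&& u \in [set: 'I_k], v \in [set: 'I_k]
    & Bgraph k phi u v]].
    by apply: sym_connect_sym => u v /=; rewrite B_sym !inE.
  have to_z x : connected_in (Bgraph k phi) [set: 'I_k] z x.
    have [->|xz] := eqVneq x z; first exact: connect0.
    by apply: connect1; rewrite /= !inE Bz.
  move=> x y _ _; apply: (@connect_trans _ _ z); last exact: to_z.
  by rewrite con_sym; apply: to_z.
- exact: Bgraph_sym.
by rewrite /Bgraph eqxx.
Qed.

(** If [D] contains the centre it has at most two vertices. Otherwise it has at most two in the
    large clique and at most [phi - 2] elsewhere. *)
Lemma Bgraph_dissociation_le k phi (D : {set 'I_k}) : 2 <= phi ->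
  dissociation_set (Bgraph k phi) D -> #|D| <= phi.
Proof.
move=> phi_ge2 D_dis; case: (pickP [pred z | (z \in D) && (val z == 0)]) => [z|D0].
  case/andP=> zD /eqP z0; apply: leq_trans phi_ge2; rewrite (cardsD1 z) zD ltnS.
  apply: leq_trans (forall_inP D_dis z zD); apply/subset_leq_card/subsetP=> y.
  rewrite !inE => /andP[yz yD]; rewrite yD /Bgraph eq_sym yz z0 eqxx /=.
  by rewrite -z0 val_eqE yz.
have D_gt0 v : v \in D -> 0 < v.
  by move=> vD; have := D0 v; rewrite /= vD lt0n => /negbT.
pose A := [set v : 'I_k | phi - 2 < v].
rewrite -(cardsID A) -(subnKC phi_ge2) leq_add //.
  apply: (dissociation_clique D_dis) => x y; rewrite !inE => xA yA xy.
  have B_phi (v : 'I_k) : phi - 2 < v -> (val v != 0) && (B_group phi v == phi).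
    move=> v_phi; rewrite -lt0n (leq_ltn_trans _ v_phi) //= /B_group ifN //.
    by rewrite -leqNgt -ltnS prednK // (leq_ltn_trans _ v_phi).
  have [/andP[x0 /eqP xE] /andP[y0 /eqP yE]] := (B_phi x xA, B_phi y yA).
  by rewrite /Bgraph xy x0 y0 xE yE eqxx !orbT.
apply: (@card_ord_range _ _ 1) => v; rewrite !inE -leqNgt => /andP[v_phi /D_gt0->].
by rewrite add1n ltnS.
Qed.

(** The witness consists of vertices 1 to [phi]: all noncentral vertices of the small blocks and two
    of the large clique. For [phi = k = 2] it is the whole of K_2. *)
Lemma Bgraph_dissociation_ge k phi : 2 <= phi -> phi < k \/ phi = k /\ k = 2 ->
  exists2 D : {set 'I_k}, dissociation_set (Bgraph k phi) D & phi <= #|D|.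
Proof.
move=> phi_ge2 [phi_k|[-> ->]]; last first.
  exists [set: 'I_2]; last by rewrite cardsT card_ord.
  apply/forall_inP=> x _; apply/card_le1_eqP=> y y'.
  rewrite !inE /Bgraph /= => /andP[/eqP xy _] /andP[/eqP xy' _]; apply/val_inj => /=.
  have [nxy nxy'] : x <> y :> nat /\ x <> y' :> nat.
    by split=> [/ord_inj/xy|/ord_inj/xy'].
  by have := (ltn_ord x, ltn_ord y, ltn_ord y') => -[[]]; lia.
exists [set v : 'I_k | 0 < v <= phi]; last first.
  rewrite -[leqLHS](size_iota 1) cardE -(size_map val).
  apply: uniq_leq_size; first exact: iota_uniq.
  move=> i; rewrite mem_iota => /andP[i_gt0 i_phi].
  have i_k : i < k by lia.
  by apply/mapP; exists (Ordinal i_k); rewrite // mem_enum inE /=; lia.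
apply/forall_inP=> x; rewrite inE => x_phi; apply/card_le1_eqP=> y y'.
rewrite !inE /Bgraph => /andP[y_phi /andP[/eqP xy yg]] /andP[y'_phi /andP[/eqP
  xy' y'g]].
apply/val_inj => /=.
have [nxy nxy'] : x <> y :> nat /\ x <> y' :> nat by split=> [/ord_inj/xy|/ord_inj/xy'].
have gE (u : 'I_k) : 0 < u <= phi ->
  [|| (val x == 0) && (val u != 0), (val u == 0) && (val x != 0)
     | [&& val x != 0, val u != 0 & B_group phi x == B_group phi u]] ->
  B_group phi x = B_group phi u.
  move=> /andP[u_gt0 _]; have /andP[x_gt0 _] := x_phi.
  have [x0 u0] : (val x == 0) = false /\ (val u == 0) = false.
    by split; apply/negbTE; rewrite -lt0n.
  by rewrite x0 u0 => /eqP.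
have := (gE y y_phi yg, gE y' y'_phi y'g) => -[].
rewrite /B_group; clear -x_phi y_phi y'_phi nxy nxy' phi_ge2.
do 3![case: ifP]; lia.
Qed.

Lemma Bgraph_in_Bl k phi : 2 <= k -> 2 <= phi -> phi < k \/ phi = k /\ k = 2 ->
  in_Bl phi (Bgraph k phi).
Proof.
move=> k_ge2 phi_ge2 phi_k; split; first by apply: Bgraph_block_graph; apply: ltnW.
apply/eqP; rewrite eqn_leq; apply/andP; split.
  by apply/bigmax_leqP=> D; apply: Bgraph_dissociation_le.
have [D D_dis D_phi] := Bgraph_dissociation_ge phi_ge2 phi_k.
by apply: leq_trans D_phi _; apply: leq_bigmax_cond.
Qed.

Lemma max_dissociation_set k (g : rel 'I_k) :
  exists2 D : {set 'I_k}, dissociation_set g D & #|D| = dissociation_number g.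
Proof.
have D0 : 0 < #|[pred D : {set 'I_k} | dissociation_set g D]|.
  apply/card_gt0P; exists set0; rewrite inE.
  by apply/forall_inP=> v; rewrite inE.
by have [D D_dis DE] := eq_bigmax_cond (fun D : {set 'I_k} => #|D|) D0; exists D.
Qed.

(** If all vertices form a dissociation set, a vertex of level 2 would give its parent a second
    neighbour besides [c]. Hence all vertices are adjacent to [c], which has at most one
    neighbour. *)
Lemma in_Bl_order k phi (g : rel 'I_k) : 2 <= k -> in_Bl phi g ->
  phi < k \/ phi = k /\ k = 2.
Proof.
move=> k_ge2 [[[g_irr g_sym] [g_conn g_blocks]] phiE].
have [D D_dis cardD] := max_dissociation_set g; rewrite phiE in cardD.
have := max_card (mem D); rewrite cardD card_ord leq_eqVlt => /predU1P[phi_k|];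
  last by left.
right; split=> //; apply/eqP; rewrite eqn_leq k_ge2 andbT leqNgt; apply/negP=> k_gt2.
have DT v : v \in D.
  have /eqP-> : D == [set: 'I_k] by rewrite eqEcard subsetT cardsT card_ord cardD
    phi_k leqnn.
  by rewrite inE.
pose c := Ordinal (ltnW k_ge2).
have [lvl [lvl_eq0 lvl_adj lvl_parent]] := bfs_levels c g_conn.
have adj_c v : v != c -> g c v.
  move=> vc; apply/negPn/negP=> ncv.
  have v_ge2 : 1 < lvl v.
    by rewrite ltn_neqAle eq_sym (lvl1 g_irr lvl_eq0 lvl_adj lvl_parent) ncv lt0n
      lvl_eq0.
  have [y y2] := lvl_below lvl_parent v_ge2.
  have [|u guy] := lvl_parent y; first by rewrite y2.
  rewrite y2 => -[/esym/eqP]; rewrite (lvl1 g_irr lvl_eq0 lvl_adj lvl_parent) => gcu.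
  have yc : y = c by apply: (dissociation_inj D_dis (DT u)) => //; rewrite g_sym.
  by have := lvl_eq0 c; rewrite -yc y2 eqxx.
have := dissociation_inj D_dis (DT c) (DT (Ordinal k_ge2)) (DT (Ordinal k_gt2)).
by case/(_ (adj_c (Ordinal k_ge2) isT) (adj_c (Ordinal k_gt2) isT)).
Qed.

(** * Comparison of quadratic forms *)

Section WeightedSums.
Local Open Scope ring_scope.
Variables (k : nat) (x : 'I_k -> algC).
Hypothesis x_gt0 : forall i, 0 < x i.

Let x_ge0 i : 0 <= x i := ltW (x_gt0 i).

Lemma exists_argmax (T : finType) (P : pred T) (F : T -> algC) i0 :
  P i0 -> (forall i, 0 <= F i) -> exists2 i, P i & forall j, P j -> F j <= F i.
Proof.
move=> Pi0 F_ge0; have F_real : {in P, forall i, F i \is Num.real}.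
  by move=> i _; apply: ger0_real.
by case: (real_arg_maxP Pi0 F_real) => i Pi i_max; exists i.
Qed.

(** With positive weights, equal sums leave no room for a vertex satisfying [q] but not [p]. *)
Lemma weighted_row_eq (p q : pred 'I_k) : subpred p q ->
  \sum_j (p j)%:R * x j = \sum_j (q j)%:R * x j -> p =1 q.
Proof.
move=> sub_pq /esym/eqP; rewrite -subr_eq0 -sumrB => /eqP sum0 j.
have ge0 i : true -> 0 <= (q i)%:R * x i - (p i)%:R * x i.
  move=> _; rewrite subr_ge0; case: (boolP (p i)) => [/sub_pq->//|_].
  by rewrite mul0r mulr_ge0.
have /eqP : (q j)%:R * x j - (p j)%:R * x j = 0 by exact: (psumr_eq0P ge0 sum0).
rewrite -mulrBl mulf_eq0 (gt_eqF (x_gt0 j)) orbF subr_eq0 eqr_nat.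
by case: (p j) (q j) => [] [].
Qed.

(** A quadratic form with natural multiplicities, so that edges can be counted pointwise in [nat];
    on a graph it is [quad_form]. *)
Definition wsum (F : 'I_k -> 'I_k -> nat) : algC :=
  \sum_u \sum_v (F u v)%:R * (x u * x v).

Lemma wsum_le F G : (forall u v, F u v <= G u v)%N -> wsum F <= wsum G.
Proof.
move=> FG; apply: ler_sum => u _; apply: ler_sum => v _.
by rewrite ler_wpM2r ?mulr_ge0 // ler_nat.
Qed.

Lemma wsumD F G : wsum (fun u v => F u v + G u v)%N = wsum F + wsum G.
Proof.
rewrite -big_split; apply: eq_bigr => u _; rewrite -big_split; apply: eq_bigr => v _.
by rewrite natrD mulrDl.
Qed.

Lemma wsum_sym F : wsum (fun u v => F v u) = wsum F.
Proof.
rewrite /wsum exchange_big; apply: eq_bigr => u _; apply: eq_bigr => v _.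
by rewrite (mulrC (x u)).
Qed.

Lemma wsum_row_le (P : pred 'I_k) F G :
  (forall u, P u -> \sum_v (F u v)%:R * x v <= \sum_v (G u v)%:R * x v) ->
  wsum (fun u v => P u * F u v)%N <= wsum (fun u v => P u * G u v)%N.
Proof.
move=> FG; apply: ler_sum => u _.
have rowE H : \sum_v (P u * H u v)%:R * (x u * x v)
    = (P u)%:R * x u * \sum_v (H u v)%:R * x v :> algC.
  by rewrite mulr_sumr; apply: eq_bigr => v _; rewrite natrM; ring.
rewrite !rowE; have [Pu|_] := boolP (P u); last by rewrite !mul0r.
by rewrite ler_wpM2l ?mul1r ?FG.
Qed.

End WeightedSums.

Section Comparison.
Local Open Scope ring_scope.
Variables (k : nat) (g h sb : rel 'I_k) (c a : 'I_k) (pr : 'I_k -> 'I_k).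
Variables (A Q : {set 'I_k}) (x : 'I_k -> algC).
Hypotheses (x_gt0 : forall i, 0 < x i) (x_max : forall v, x v <= x c).
Hypotheses (g_irr : irreflexive g) (h_sym : symmetric h).
Hypotheses (sb_irr : irreflexive sb) (sb_sym : symmetric sb) (sb_c : forall v, sb
  c v = false).
Hypothesis edges : forall u v, g u v ->
  [\/ sb u v, v != c /\ u = pr v | u != c /\ v = pr u].
Hypotheses (cA : c \notin A) (cQ : c \notin Q) (AQ : [disjoint A & Q]).
Hypothesis A_closed : forall u v, u \in A -> sb u v -> v \in A.
Hypothesis A_heavy : forall u, u != c ->
  \sum_v (sb u v || (v == u))%:R * x v <= \sum_v (v \in A)%:R * x v.
Hypothesis h_c : forall v, v != c -> h c v.
Hypothesis h_A : forall u v, u \notin c |: Q -> v \notin c |: Q -> u != v -> h u v.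
Hypothesis h_Q : {in Q &, forall u v, sb u v -> h u v}.

Let R := ~: (c |: (A :|: Q)).

(* Besides the edges of [g] and [h], the terms are the new edges between [R] and
   [A] against the lost sibling edges between [R] and [Q], and the new edges at
   [c] against the parent edges; compare_quad_form shows that, summed with
   weights [x u * x v], the new ones outweigh the lost ones. *)
Lemma compare_pointwise u v :
  (g u v + ((u \in R) * (v \in A) + (v \in R) * (u \in A))
         + ((u == c) * (v != c) + (v == c) * (u != c))
   <= h u v + ((u \in R) * (sb u v && (v \in Q)) + (v \in R) * (sb v u && (u \in Q)))
            + ((v != c) * (u == pr v) + (u != c) * (v == pr u)))%N.
Proof.
have inR w : (w \in R) = [&& w != c, w \notin A & w \notin Q].
  by rewrite !inE !negb_or.
have sb_cr w : sb w c = false by rewrite sb_sym sb_c.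
have [->|uc] := eqVneq u c.
  rewrite sb_c sb_cr !inR eqxx (negbTE cA) /= !(muln0, mul0n, mul1n, add0n, addn0).
  have [->|vc] := eqVneq v c; first by rewrite g_irr.
  rewrite (h_c vc) /=; case: (boolP (g c v)) => //= /edges[]; rewrite ?sb_c //.
    by case=> _ <-; rewrite eqxx.
  by rewrite eqxx => -[].
have [->|vc] := eqVneq v c.
  rewrite sb_c sb_cr !inR eqxx (negbTE cA) /= !(muln0, mul0n, mul1n, add0n, addn0).
  rewrite h_sym (h_c uc) /=; case: (boolP (g u c)) => //= /edges[]; rewrite ?sb_cr //.
    by rewrite eqxx => -[].
  by case=> _ <-; rewrite eqxx addn1.
rewrite /= !mul0n !addn0 !mul1n.
(* Siblings lie both inside or both outside [A], so no new edge is counted here. The edge survives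
   in [h] unless exactly one end is in [Q], and then the other end is in [R]. *)
have [sb_uv|nsb_uv] := boolP (sb u v).
  have sb_vu : sb v u by rewrite sb_sym.
  have AE : (u \in A) = (v \in A) by apply/idP/idP=> /A_closed; apply.
  have RA : ((u \in R) * (v \in A) + (v \in R) * (u \in A) = 0)%N.
    by rewrite !inR AE; case: (v \in A); rewrite /= !(andbF, muln0, mul0n).
  rewrite RA addn0 sb_vu; apply: leq_trans (leq_b1 _) _.
  apply: leq_trans (leq_addr _ _).
  have [uQ|uQ] := boolP (u \in Q).
    have [vQ|vQ] := boolP (v \in Q); first by rewrite (h_Q uQ vQ sb_uv).
    have uA : u \notin A by apply: contraL uQ => /(disjointFr AQ)->.
    by rewrite !inR vc vQ -AE uA /= !(muln1, mul1n) addnA addn1.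
  have [vQ|vQ] := boolP (v \in Q).
    have vA : v \notin A by apply: contraL vQ => /(disjointFr AQ)->.
    by rewrite !inR uc uQ AE vA /= !(muln1, mul1n) addnA addnAC addn1.
  have uv : u != v by apply: contraTneq sb_uv => ->; rewrite sb_irr.
  by rewrite h_A // in_setU1 negb_or ?uc ?vc.
(* Between nonsiblings, pairs from [R] and [A] lie in the large clique of [h], and an edge of [g] is
   a parent edge. *)
have RAh : ((u \in R) * (v \in A) + (v \in R) * (u \in A) <= h u v)%N.
  have NQ w : w \in A -> w \notin Q by move=> /(disjointFr AQ)->.
  rewrite !inR uc vc; case: (boolP (u \in A)) => uA; case: (boolP (v \in A)) => vA //=.
  - case: (boolP (v \in Q)) => vQ //=.
    have uv : u != v by apply: contraNneq vA => <-.
    by rewrite h_A // in_setU1 negb_or ?uc ?vc ?vQ ?NQ.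
  - rewrite muln0; case: (boolP (u \in Q)) => uQ //=.
    have uv : u != v by apply: contraNneq uA => ->.
    by rewrite h_A // in_setU1 negb_or ?uc ?vc ?uQ ?NQ.
  by rewrite !muln0.
have gP : (g u v <= (u == pr v) + (v == pr u))%N.
  case: (boolP (g u v)) => //= /edges[sb_uv|[_ <-]|[_ <-]]; rewrite ?eqxx ?addn1 //.
  by rewrite sb_uv in nsb_uv.
rewrite addnC; apply: leq_trans (leq_add RAh gP) _.
by rewrite leq_add2r leq_addr.
Qed.

Lemma compare_quad_form : quad_form g x <= quad_form h x.
Proof.
pose RA u v := ((u \in R) * (v \in A))%N; pose C u v := ((u == c) * (v != c))%N.
pose RQ u v := ((u \in R) * (sb u v && (v \in Q)))%N.
pose P u v := ((u != c) * (v == pr u))%N.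
have x_ge0 i : 0 <= x i by apply: ltW.
(* For [u] in [R], the siblings in [Q] weigh at most the class of [u], hence at most [A]. *)
have RQ_RA : wsum x RQ <= wsum x RA.
  apply: (wsum_row_le x_gt0 (P := mem R) (F := fun u v => sb u v && (v \in Q))
            (G := fun u v => v \in A)) => u uR.
  apply: le_trans (A_heavy (u := u) _); last by move: uR;
    rewrite !inE negb_or => /andP[].
  apply: ler_sum => v _; rewrite ler_wpM2r // ler_nat.
  by case: (sb u v) => //=; case: (v \in Q).
(* Moving the parent of [u] to [c] gains because [x] is maximal at [c]. *)
have P_C : wsum x P <= wsum x C.
  rewrite -[leRHS]wsum_sym.
  have -> : wsum x (fun u v => C v u) = wsum x (fun u v => ((u != c) * (v == c))%N).
    by apply: eq_bigr => u _; apply: eq_bigr => v _; rewrite /C mulnC.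
  apply: (wsum_row_le x_gt0 (P := fun u => u != c) (F := fun u v => v == pr u)
            (G := fun u v => v == c)) => u _.
  have single w : \sum_v (v == w)%:R * x v = x w.
    rewrite (bigD1 w) //= eqxx mul1r big1 ?addr0 // => v /negbTE->.
    by rewrite mul0r.
  by rewrite !single.
have := wsum_le x_gt0 compare_pointwise; rewrite !wsumD.
rewrite (wsum_sym x RA) (wsum_sym x RQ) (wsum_sym x C) (wsum_sym x P).
rewrite -/(quad_form g x) -/(quad_form h x) => le_sum.
have le_rest : wsum x RQ + wsum x RQ + (wsum x P + wsum x P)
    <= wsum x RA + wsum x RA + (wsum x C + wsum x C).
  by do 2![apply: lerD => //]; apply: lerD.
rewrite -(lerD2r (wsum x RA + wsum x RA + (wsum x C + wsum x C))).
by rewrite addrA (le_trans le_sum) // -addrA lerD2l.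
Qed.

End Comparison.

(** * The spectral bound, its equality case and the extremal graph *)

Lemma in_Bl_spectral_radius k phi (g : rel 'I_k) :
  2 <= k -> 2 <= phi -> in_Bl phi g ->
  (spectral_radius g <= spectral_radius (Bgraph k phi))%R /\
  (spectral_radius g = spectral_radius (Bgraph k phi) -> isomorphic g (Bgraph k phi)).
Proof.
move=> k_ge2 phi_ge2 [[[g_irr g_sym] [g_conn g_blocks]] phiE].
have k_gt0 : 0 < k by apply: ltnW.
have [x [x_gt0 xE]] := perron_vector g_sym g_conn k_gt0.
have x_ge0 i : (0 <= x i)%R by apply: ltW.
have [c _ x_max] := exists_argmax (P := predT) (i0 := Ordinal k_gt0) isT x_ge0.
have [lvl [lvl_eq0 lvl_adj lvl_parent]] := bfs_levels c g_conn.
pose sb := sib g lvl; pose cl := sibs g lvl.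
have sb_sym : symmetric sb by apply: sib_sym.
have sb_c v : sb c v = false by apply: sib_root.
have sb_irr : irreflexive sb by move=> v; rewrite /sb /sib g_irr.
pose weight u := (\sum_v (v \in cl u)%:R * x v)%R.
have [i0 i0_c] : exists i, i != c.
  have : 0 < #|[set~ c]| by rewrite cardsC1 card_ord; case: (k) k_ge2 => [|[]].
  by case/card_gt0P=> i; rewrite !inE; exists i.
have [a a_c a_max] : exists2 a, a != c & forall u, u != c -> (weight u <= weight a)%R.
  apply: (exists_argmax (P := fun u => u != c) i0_c) => u.
  by apply: sumr_ge0 => v _; rewrite mulr_ge0.
have [D D_dis cardD] := max_dissociation_set g; rewrite phiE in cardD.
have [Q0 [sQ0 cardQ0 Q0_inj]] :=
  residual_set g_irr g_sym g_blocks lvl_eq0 lvl_adj lvl_parent a_c D_dis.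
(* The set is trimmed to exactly [phi - 2] vertices, the number of noncentral places in the small
   blocks. *)
rewrite cardD in cardQ0; have [Q sQ cardQ] := subset_of_card cardQ0.
have {}sQ0 : Q \subset ~: (c |: cl a) by apply: subset_trans sQ0.
have Q_inj : {in Q & &, forall u v w, sb u v -> sb u w -> v = w}.
  by move=> u v w /(subsetP sQ)? /(subsetP sQ)? /(subsetP sQ)?; apply: Q0_inj.
have cQ : c \notin Q by apply/negP=> /(subsetP sQ0); rewrite !inE eqxx.
have clQ : [disjoint cl a & Q].
  rewrite disjoint_sym disjoints_subset; apply: subset_trans sQ0 _.
  by rewrite setCS subsetUr.
have c_cl : c \notin cl a.
  by rewrite inE eq_sym (negbTE a_c) -/(sb a c) sb_sym sb_c.
have cl_closed u v : u \in cl a -> sb u v -> v \in cl a.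
  rewrite !inE => /predU1P[->|sb_au] sb_uv; first by apply/orP; right.
  have [//|va] := eqVneq v a; apply/orP; right.
  by apply: sib_trans sb_au sb_uv => //; rewrite eq_sym.
have [f [h_c h_A h_Q]] := Bgraph_placement phi_ge2 cQ cardQ sb_sym sb_irr Q_inj.
pose h : rel 'I_k := fun u v => Bgraph k phi (f u) (f v).
have h_sym : symmetric h by move=> u v; apply: Bgraph_sym.
have h_irr : irreflexive h by move=> v; rewrite /h /Bgraph eqxx.
have edges := edge_cases g_irr g_sym g_blocks lvl_eq0 lvl_adj lvl_parent.
have le_gh : (quad_form g x <= quad_form h x)%R.
  apply: (compare_quad_form (sb := sb) (c := c) (pr := par g c lvl) (A := cl a)
    (Q := Q)) => //.
    by move=> v; apply: x_max.
  move=> u u_c; apply: le_trans (a_max u u_c).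
  by apply: ler_sum => v _; rewrite inE orbC.
have norm_gt0 : (0 < \sum_i x i ^+ 2)%R.
  rewrite (bigD1 c) //= ltr_wpDr ?exprn_gt0 // sumr_ge0 // => i _.
  exact: exprn_ge0.
have gE := eigen_quad_form xE.
have h_le := quad_form_le h_sym x_ge0.
have hB : spectral_radius h = spectral_radius (Bgraph k phi).
  by apply: spectral_radius_iso; exists f.
rewrite -hB; split=> [|gh].
  by rewrite -(ler_pM2r norm_gt0) -gE (le_trans le_gh).
(* Equal spectral radii force [x] to reach the Rayleigh bound of [h] as well, so it is an
   eigenvector of both graphs. *)
have rows u : (\sum_v (g u v)%:R * x v = \sum_v (h u v)%:R * x v)%R.
  rewrite xE gh; apply/esym; apply: quad_form_eq => //.
  by apply/eqP; rewrite eq_le h_le -gh -gE.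
have row_eq u : (forall w, g u w -> h u w) -> g u =1 h u.
  by move=> gh_u; apply: (weighted_row_eq x_gt0 gh_u).
(* In [h] the centre is adjacent to everything, so the rows of [c] agree and [g] has only levels 0
   and 1. *)
have g_c w : w != c -> g c w.
  move=> wc; rewrite row_eq; first exact: h_c.
  by move=> t /(edge_neq g_irr); rewrite eq_sym => /h_c.
have g_sb t w : t != c -> w != c -> g t w -> sb t w.
  move=> tc wc gtw; rewrite /sb /sib gtw.
  have lvl_1 s : s != c -> lvl s = 1.
    by move=> /g_c; rewrite -(lvl1 g_irr lvl_eq0 lvl_adj lvl_parent) => /eqP.
  by rewrite !lvl_1.
have h_c' w : w != c -> h w c by move=> wc; rewrite h_sym; apply: h_c.
have a_cl : a \in cl a by rewrite inE eqxx.
have out_Q w : w \in cl a -> w \notin c |: Q.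
  by move=> w_a; rewrite in_setU1 negb_or (disjointFr clQ) // andbT;
    apply: contraNneq c_cl => <-.
(* The neighbours of [a] in [g] are now [c] and siblings, all adjacent to [a] in [h]. *)
have row_a : g a =1 h a.
  apply: row_eq => w gaw; have [->|wc] := eqVneq w c; first exact: h_c'.
  have w_a : w \in cl a by apply: (cl_closed a w a_cl); apply: g_sb.
  by apply: h_A; rewrite ?out_Q ?(edge_neq g_irr).
(* Such a vertex is adjacent to [a] in [h], hence in [g]; so the class of [a] is everything outside
   [c] and [Q]. *)
have rest_cl w : w \notin c |: Q -> w \in cl a.
  move=> wQ; have [->//|wa] := eqVneq w a.
  have wc : w != c by move: wQ; rewrite in_setU1 negb_or => /andP[].
  apply: (cl_closed a w a_cl); apply: g_sb => //; rewrite row_a.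
  by apply: (h_A a w _ wQ); [apply: out_Q a_cl|rewrite eq_sym].
(* An edge of [g] avoiding [c] joins siblings. It lies inside [Q] or inside the class of [a], since
   that class is closed under siblings and disjoint from [Q]. *)
exists f => u v; suff -> : g u v = h u v by [].
move: v; apply: row_eq => w guw; have [uc|uc] := eqVneq u c.
  by rewrite uc in guw *; apply: h_c; rewrite eq_sym (edge_neq g_irr).
have [->|wc] := eqVneq w c; first exact: h_c'.
have sb_uw := g_sb u w uc wc guw.
have [uQ|uQ] := boolP (u \in Q); have [wQ|wQ] := boolP (w \in Q).
- exact: h_Q.
- have w_a : w \in cl a by apply: rest_cl; rewrite in_setU1 negb_or wc.
  have u_a : u \in cl a by apply: (cl_closed w u w_a); rewrite sb_sym.
  by rewrite (disjointFr clQ u_a) in uQ.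
- have u_a : u \in cl a by apply: rest_cl; rewrite in_setU1 negb_or uc.
  by rewrite (disjointFr clQ (cl_closed _ _ u_a sb_uw)) in wQ.
by apply: h_A; rewrite ?in_setU1 ?negb_or ?uc ?wc // (edge_neq g_irr).
Qed.

Theorem theorem3p7 (k phi : nat) :
  2 <= k -> 2 <= phi ->
  (exists g : rel 'I_k, in_Bl phi g) ->
  (forall g : rel 'I_k, in_Bl phi g ->
     (max_spectral_in_Bl phi g <-> isomorphic g (Bgraph k phi))) /\
  max_spectral_in_Bl phi (Bgraph k phi).
Proof.
move=> k_ge2 phi_ge2 [g0 g0_Bl].
have B_Bl : in_Bl phi (Bgraph k phi).
  by apply: Bgraph_in_Bl => //; apply: in_Bl_order g0_Bl.
have B_max : max_spectral_in_Bl phi (Bgraph k phi).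
  by split=> // h /(in_Bl_spectral_radius k_ge2 phi_ge2)[].
split=> // g g_Bl; have [g_le g_eq] := in_Bl_spectral_radius k_ge2 phi_ge2 g_Bl.
split=> [[_ g_max]|g_iso].
  by apply: g_eq; apply/eqP; rewrite eq_le g_le g_max.
by split=> // h /(in_Bl_spectral_radius k_ge2 phi_ge2)[h_le _];
  rewrite (spectral_radius_iso g_iso).
Qed.
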